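(* Suppose that $(X,T)$ is a topological dynamical system. Then the following are equivalent: (1) $(X,T)$ is mean proximal. (2) $(X,T)$ is mean asymptotic. (3) Every measure $\lambda\in M(X\times X,T\times T)$ satisfies $\lambda(\Delta_X)=1$. (4) $(X,T)$ is uniquely ergodic and the unique measure of $M(X,T)$ is a delta measure $\delta_{x_0}$ on a fixed point $x_0$ (the unique fixed point). (5) $(X\times X,T\times T)$ is mean proximal.
   Context: A topological dynamical system (TDS) is a pair $(X,T)$ where $X$ is a compact metric space with metric $d$ and $T:X\to X$ is continuous. A pair $(x,y)\in X\times X$ is mean proximal if $\liminf_{n\to\infty}\frac1n\sum_{i=0}^{n-1}d(T^i x,T^i y)=0$, and mean asymptotic if $\lim_{n\to\infty}\frac1n\sum_{i=0}^{n-1}d(T^i x,T^i y)=0$. A TDS $(X,T)$ is mean proximal (respectively mean asymptotic) if every pair $(x,y)\in X\times X$ is mean proximal (respectively mean asymptotic). $M(X,T)$ denotes the set of all $T$-invariant Borel probability measures on $X$; $(X,T)$ is uniquely ergodic if $M(X,T)$ consists of exactly one measure. $\delta_{x_0}$ is the point mass at $x_0$. $\Delta_X=\{(x,x):x\in X\}$ is the diagonal. $T\times T$ acts on $X\times X$ by $(x,y)\mapsto(Tx,Ty)$, and $X\times X$ is equipped with a metric inducing the product topology, e.g. $\max\{d(x,x'),d(y,y')\}$. *)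

(* Defs.v *)
From HB Require Import structures.
From mathcomp Require Import all_boot all_order all_algebra.
From mathcomp Require Import all_classical all_reals all_analysis.

Set Implicit Arguments.
Unset Strict Implicit.
Unset Printing Implicit Defensive.

Import Order.TTheory GRing.Theory Num.Theory.
Import numFieldNormedType.Exports.

Local Open Scope classical_set_scope.
Local Open Scope ring_scope.

(* Pointedness only encodes that the space is nonempty; the chosen point plays
   no role. *)
#[short(type="pmetricType")]
HB.structure Definition PointedMetric (K : numDomainType) :=
  {M of Pointed M & Metric K M}.

HB.instance Definition _ (X Y : ptopologicalType) := Pointed.on (X * Y)%type.

Notation borel X := (g_sigma_algebraType (@open X)).

(* [rho] is a metric inducing the given topology of [Y]. *)
Definition compatible_metric (R : realType) (Y : topologicalType)
    (rho : Y -> Y -> R) : Prop :=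
  [/\ forall p, rho p p = 0,
      forall p q, rho p q = 0 -> p = q,
      forall p q, rho p q = rho q p,
      forall p q r, rho p r <= rho p q + rho q r
    & forall p, nbhs p = nbhs_ball_ (fun x e => [set y | rho x y < e]) p].

Definition max_dist (R : realType) (X : metricType R) (p q : X * X) : R :=
  Num.max (mdist p.1 q.1) (mdist p.2 q.2).

Lemma max_dist_compatible (R : realType) (X : metricType R) :
  compatible_metric (@max_dist R X).
Proof.
split.
- by move=> p; rewrite /max_dist !mdistxx maxxx.
- move=> [a b] [c d]; rewrite /max_dist /= => /eqP.
  rewrite eq_le ge_max => /andP[/andP[ac bd] _].
  by congr pair; apply: (@mdist_positivity R); apply/eqP; rewrite eq_le mdist_ge0 andbT.
- by move=> p q; rewrite /max_dist !(metric_sym _ p.1) !(metric_sym _ p.2)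
    (metric_sym p.1) (metric_sym p.2).
- move=> p q r; rewrite /max_dist ge_max; apply/andP; split.
    by apply: le_trans (metric_triangle _ q.1 _) _; apply: lerD; rewrite le_max lexx.
  by apply: le_trans (metric_triangle _ q.2 _) _; apply: lerD; rewrite le_max lexx orbT.
- move=> p; rewrite -nbhs_ballE; congr (nbhs_ball_ _ p).
  apply/funext => x; apply/funext => e; apply/seteqP; split => y /=.
    by case=> /=; rewrite !ballEmdist /max_dist gt_max /= => -> ->.
  by rewrite /max_dist gt_max => /andP[? ?]; split => /=; rewrite ballEmdist.
Qed.

Section mean_pairs.
Context (R : realType) (Y : Type) (dist : Y -> Y -> R) (T : Y -> Y).

(* The term of index 0 is 0 (as 0^-1 = 0) and does not affect limits. *)
Definition mean_dist (x y : Y) : R^nat :=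
  fun n => n%:R^-1 * \sum_(0 <= i < n) dist (iter i T x) (iter i T y).

(* The liminf is taken in the extended reals, where it always exists. *)
Definition mean_proximal_pair (x y : Y) : Prop :=
  limn_einf (EFin \o mean_dist x y) = 0%E.

Definition mean_asymptotic_pair (x y : Y) : Prop :=
  mean_dist x y @ \oo --> (0 : R).

Definition mean_proximal : Prop := forall x y, mean_proximal_pair x y.

Definition mean_asymptotic : Prop := forall x y, mean_asymptotic_pair x y.

End mean_pairs.

Definition prod_map (X : Type) (T : X -> X) (p : X * X) : X * X :=
  (T p.1, T p.2).

Section invariant_measures.
Context (R : realType) (X : ptopologicalType) (T : X -> X).

Definition invariant_measures : set (probability (borel X) R) :=
  [set mu | forall A : set (borel X), measurable A -> mu (T @^-1` A) = mu A].

(* Measures are functions on all subsets, so two measures are identified when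
   they agree on Borel sets; Leibniz equality would be too strong. *)
Definition borel_eq (mu nu : set (borel X) -> \bar R) : Prop :=
  forall A : set (borel X), measurable A -> mu A = nu A.

Definition uniquely_ergodic : Prop :=
  exists2 mu, invariant_measures mu &
    forall nu, invariant_measures nu -> borel_eq nu mu.

End invariant_measures.
Arguments invariant_measures R {X} T.
Arguments uniquely_ergodic R {X} T.

(* Main.v *)
Require Import Defs.
From HB Require Import structures.
From mathcomp Require Import all_boot all_order all_algebra.
From mathcomp Require Import all_classical all_reals all_analysis.
From mathcomp Require Import measurable_realfun.
From mathcomp Require Import lra.

Set Implicit Arguments.
Unset Strict Implicit.
Unset Printing Implicit Defensive.

Import Order.TTheory GRing.Theory Num.Theory.
Import numFieldNormedType.Exports.

Local Open Scope classical_set_scope.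
Local Open Scope ring_scope.

(** The link between metric averages and invariant measures goes through one
    function on one system: with [S := prod_map T] and [d (x, y) := mdist x y], the
    averages in the definition of mean proximality are the ergodic averages of [d]
    along the [S]-orbit of [(x, y)], and [d] vanishes exactly on the diagonal.

    Mean proximal implies mean asymptotic by compactness alone
    ([uniformly_small_ergodic_mean]): if every point has one small average, then
    some [N] bounds the length needed at all points, every long orbit segment
    is cut into pieces of length at most [N] with small averages, and all long
    averages are uniformly small.  Integrated against an invariant measure,
    uniformly small averages force the integral of [d] to be 0, so the measure
    lives on the diagonal ([invariant_measure_zero_set]).

    The converse direction, from measures to averages, needs invariant measures
    to exist ([krylov_bogolyubov]).  If the orbit of a point visits a closed set
    with frequency at least [c > 0] at arbitrarily large times, then some
    invariant Borel probability gives that set mass at least [c].  It is built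
    from sets rather than from a positive functional on continuous functions: an
    ultrafilter limit of visit frequencies is an invariant finitely additive
    probability on all subsets, and [regular_borel_extension] turns it into a
    Borel measure by inner approximation of open sets by closed ones, outer
    approximation of arbitrary sets by open ones, and the Caratheodory criterion.
    Consequently ([ergodic_mean_cvg0]) the averages of a nonnegative continuous
    function tend to 0 as soon as each invariant measure lives on its zero set.

    Applied to [d], this shows that a system all of whose invariant measures on
    pairs live on the diagonal is mean asymptotic.  In such a system the orbit of
    [(x, T x)] forces points with [d (y, T y)] arbitrarily small, hence a fixed
    point [x0]; the averages of the distance to [x0] are uniformly small, so
    every invariant measure is the point mass at [x0].  Conversely, if the point
    mass at [x0] is the only invariant measure, the averages of the distance to
    [x0] tend to 0 along every orbit.  On a compact space a continuous function
    is dominated, up to a small constant, by a multiple of any nonnegative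
    continuous function whose zeros lie among its own ([compact_dominated]); this
    carries the convergence to every metric on the square, and brings mean
    proximality of the square back to the original system. *)

(** * Ergodic averages *)

Definition ergodic_mean (R : realType) (Z : Type) (S : Z -> Z) (f : Z -> R)
    (n : nat) (z : Z) : R :=
  n%:R^-1 * \sum_(0 <= i < n) f (iter i S z).

Section ergodic_mean.
Context (R : realType) (Z : Type) (S : Z -> Z).
Implicit Types (f g : Z -> R) (n : nat) (z : Z).

Lemma ergodic_mean_ge0 f n z :
  (forall z, 0 <= f z) -> 0 <= ergodic_mean S f n z.
Proof. by move=> f0; rewrite mulr_ge0 ?invr_ge0 ?ler0n ?sumr_ge0. Qed.

Lemma ergodic_mean_le f g n z :
  (forall z, f z <= g z) -> ergodic_mean S f n z <= ergodic_mean S g n z.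
Proof.
by move=> fg; rewrite ler_wpM2l ?invr_ge0 ?ler0n// ler_sum.
Qed.

Lemma ergodic_meanD f g n z :
  ergodic_mean S (fun z => f z + g z) n z =
  ergodic_mean S f n z + ergodic_mean S g n z.
Proof. by rewrite /ergodic_mean big_split mulrDr. Qed.

Lemma ergodic_meanZ c f n z :
  ergodic_mean S (fun z => c * f z) n z = c * ergodic_mean S f n z.
Proof. by rewrite /ergodic_mean -mulr_sumr mulrCA. Qed.

Lemma ergodic_mean_cst (c : R) n z :
  (0 < n)%N -> ergodic_mean S (fun=> c) n z = c.
Proof.
move=> n0; rewrite /ergodic_mean sumr_const_nat subn0 -[c *+ n]mulr_natl mulrA.
by rewrite mulVf ?mul1r// pnatr_eq0 -lt0n.
Qed.

Lemma ergodic_mean_affine_le f g e C n z : (0 < n)%N ->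
  (forall z, f z <= e + C * g z) ->
  ergodic_mean S f n z <= e + C * ergodic_mean S g n z.
Proof.
move=> n0 fg; apply: le_trans (ergodic_mean_le n z fg) _.
by rewrite ergodic_meanD ergodic_meanZ ergodic_mean_cst.
Qed.

(** The averages of [f \o S] and of [f] telescope: they differ only by the two
    end terms. *)
Lemma ergodic_mean_shift f n z :
  ergodic_mean S (f \o S) n z - ergodic_mean S f n z =
  n%:R^-1 * (f (iter n S z) - f z).
Proof.
rewrite -mulrBr -sumrB; congr (_ * _) => /=.
exact: (telescope_sumr (fun i => f (iter i S z)) (leq0n n)).
Qed.

End ergodic_mean.

Lemma ergodic_mean_factor (R : realType) (W Z : Type) (Q : W -> W) (S : Z -> Z)
    (p : W -> Z) (f : Z -> R) n w :
  (forall w, p (Q w) = S (p w)) ->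
  ergodic_mean Q (f \o p) n w = ergodic_mean S f n (p w).
Proof.
move=> pQ; congr (_ * _); apply: eq_bigr => i _ /=; congr f.
by elim: i => //= i <-.
Qed.

Lemma iter_prod_map (Y : Type) (T : Y -> Y) n p :
  iter n (prod_map T) p = (iter n T p.1, iter n T p.2).
Proof. by elim: n => [|n IH] /=; [case: p|rewrite IH]. Qed.

Lemma mean_distE (R : realType) (Y : Type) (dist : Y -> Y -> R) (T : Y -> Y)
    x y n :
  mean_dist dist T x y n =
  ergodic_mean (prod_map T) (fun p => dist p.1 p.2) n (x, y).
Proof.
by congr (_ * _); apply: eq_bigr => i _; rewrite iter_prod_map.
Qed.

Lemma continuous_iter (Z : topologicalType) (S : Z -> Z) n :
  continuous S -> continuous (iter n S).
Proof.
move=> cS; elim: n => [|n IH] z /=; first exact: cvg_id.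
exact: (continuous_comp (IH z) (cS _)).
Qed.

Lemma continuous_ergodic_mean (R : realType) (Z : topologicalType) (S : Z -> Z)
    (f : Z -> R) n :
  continuous S -> continuous f -> continuous (ergodic_mean S f n).
Proof.
move=> cS cf z.
apply: (@continuousM _ _ (fun=> n%:R^-1)
  (fun z => \sum_(0 <= i < n) f (iter i S z))); first exact: cvg_cst.
elim: n => [|n IH].
  have -> : (fun x => \sum_(0 <= i < 0) f (iter i S x)) = fun=> 0.
    by apply/funext => x; rewrite big_geq.
  exact: cvg_cst.
have -> : (fun x => \sum_(0 <= i < n.+1) f (iter i S x)) =
          (fun x => \sum_(0 <= i < n) f (iter i S x) + f (iter n S x)).
  by apply/funext => x; rewrite big_nat_recr.
apply: continuousD => //.
exact: (continuous_comp (@continuous_iter _ _ n cS z) (cf _)).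
Qed.

Lemma limn_einf_eq0P (R : realType) (u : R^nat) : (forall n, 0 <= u n) ->
  limn_einf (EFin \o u) = 0%E <->
  forall (e : R) N, 0 < e -> exists2 n, (N <= n)%N & u n < e.
Proof.
move=> u0.
have einf0 n : (0 <= einfs (EFin \o u) n)%E.
  by apply: le_ereal_inf_tmp => _ [k _ <-]; rewrite lee_fin.
have -> : limn_einf (EFin \o u) = ereal_sup (range (einfs (EFin \o u))).
  by rewrite limn_einf_lim; apply/cvg_lim => //; exact: cvg_einfs_sup.
split=> [sup0 e N e0|small].
  have : (einfs (EFin \o u) N < e%:E)%E.
    apply: le_lt_trans (_ : (_ <= 0)%E) _; last by rewrite lte_fin.
    by rewrite -sup0; apply: ereal_sup_ubound; exists N.
  by move=> /ereal_inf_lt[_ [n Nn <-]]; rewrite lte_fin => ?; exists n.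
apply/eqP; rewrite eq_le; apply/andP; split.
  apply: ge_ereal_sup => _ [N _ <-]; apply/lee_addgt0Pr => e e0; rewrite add0e.
  have [n Nn une] := small e N e0.
  apply: (@le_trans _ _ (u n)%:E); last by rewrite lee_fin ltW.
  by apply: ereal_inf_lbound; exists n.
by apply: le_trans (einf0 0%N) _; apply: ereal_sup_ubound; exists 0%N.
Qed.

(** * Domination on compact spaces *)

(** The open sets [g < e + n * h] increase with [n] and cover the space: where
    [h] vanishes already [n = 0] will do, elsewhere a large [n] will. *)
Lemma compact_dominated (R : realType) (Z : topologicalType) (g h : Z -> R) (e : R) :
  compact [set: Z] -> continuous g -> continuous h ->
  (forall z, 0 <= h z) -> (forall z, h z = 0 -> g z <= 0) -> 0 < e ->
  exists2 C : R, 0 < C & forall z, g z <= e + C * h z.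
Proof.
move=> /compact_near_coveringP cZ cg ch h0 gh e0.
have [|N _ HN] := cZ nat \oo (fun n z => g z < e + n%:R * h z) _; last first.
  exists N.+1%:R => // z; apply/ltW/HN => //=.
move=> z _.
have [n gz] : exists n : nat, g z - n%:R * h z < e.
  have [hz|hz] := eqVneq (h z) 0.
    by exists 0%N; rewrite hz mulr0 subr0 (le_lt_trans (gh _ hz)).
  have hz0 : 0 < h z by rewrite lt_neqAle eq_sym hz h0.
  exists (Num.truncn ((g z - e) / h z)).+1.
  by rewrite ltrBlDl -ltrBlDr -ltr_pdivrMr// Num.Theory.truncnS_gt.
exists ([set x | g x - n%:R * h x < e], [set m | (n <= m)%N]) => /=.
  split; last by exists n.
  have : {for z, continuous (fun x => g x - n%:R * h x)}.
    apply: continuousB; first exact: cg.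
    by apply: (@continuousM _ _ (fun=> n%:R) h); [exact: cvg_cst|exact: ch].
  by move=> /(_ [set y | y < e]); apply; exact: lt_nbhsl.
move=> [x m] /= [gx nm]; move: gx; rewrite ltrBlDr => /lt_le_trans; apply.
by rewrite lerD2l ler_wpM2r ?ler_nat.
Qed.

(** If every point has some small average then, by compactness, it has one of
    length at most [N] for an [N] that does not depend on the point.  Cutting a
    long orbit segment into such pieces, all but at most [N] terms of its sum
    are controlled. *)
Lemma uniformly_small_ergodic_mean (R : realType) (Z : topologicalType)
    (S : Z -> Z) (f : Z -> R) :
  compact [set: Z] -> continuous S -> continuous f -> (forall z, 0 <= f z) ->
  (forall z (e : R), 0 < e -> exists2 n, (0 < n)%N & ergodic_mean S f n z < e) ->
  forall e : R, 0 < e -> \forall n \near \oo, forall z, ergodic_mean S f n z < e.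
Proof.
move=> cZ cS cf f0 small e e0.
have [M M0 fM] : exists2 M : R, 0 < M & forall z, f z <= 1 + M * 1.
  by apply: compact_dominated => // [z|z /eqP]; [exact: cvg_cst|rewrite oner_eq0].
have e20 : 0 < e / 2 by rewrite divr_gt0.
have [|N _ HN] := (compact_near_coveringP _).1 cZ nat \oo
    (fun N z => exists2 n, (0 < n <= N)%N & ergodic_mean S f n z < e / 2) _.
  move=> z _; have [n n0 fn] := small z _ e20.
  exists ([set x | ergodic_mean S f n x < e / 2], [set m | (n <= m)%N]) => /=.
    split; last by exists n.
    have /(_ z [set y | y < e / 2]) := @continuous_ergodic_mean _ _ S f n cS cf.
    by apply; exact: lt_nbhsl.
  by move=> [x m] /= [fx nm]; exists n => //; rewrite n0.
have {}HN z := HN N (leqnn N) z Logic.I.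
pose B := N%:R * (1 + M).
have sum_le m z : \sum_(0 <= i < m) f (iter i S z) <= e / 2 * m%:R + B.
  elim/ltn_ind: m z => m IH z.
  have [mN|Nm] := leqP m N.
    apply: (@le_trans _ _ B); last by rewrite lerDr mulr_ge0// ltW.
    apply: (@le_trans _ _ (\sum_(0 <= i < m) (1 + M))).
      by apply: ler_sum => i _; have := fM (iter i S z); rewrite mulr1.
    rewrite sumr_const_nat subn0 -mulr_natl ler_wpM2r ?ler_nat//.
    by rewrite addr_ge0// ltW.
  have [n /andP[n0 nN] fn] := HN z; have nm := leq_trans nN (ltnW Nm).
  rewrite (big_cat_nat (leq0n n) nm) /=.
  have -> : \sum_(n <= i < m) f (iter i S z) =
            \sum_(0 <= i < m - n) f (iter i S (iter n S z)).
    rewrite -{1}[n]add0n big_addn; apply: eq_bigr => i _.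
    by rewrite iterD.
  have := IH (m - n)%N _ (iter n S z); rewrite ltn_subrL n0 (leq_trans n0 nm).
  move=> /(_ isT); rewrite natrB// mulrBr => IHm.
  have : \sum_(0 <= i < n) f (iter i S z) <= e / 2 * n%:R.
    by move: fn; rewrite /ergodic_mean mulrC ltr_pdivrMr ?ltr0n// => /ltW.
  by move: IHm; lra.
exists (Num.truncn (B / (e / 2))).+1 => // m /= Bm z.
have m0 : 0 < m%:R :> R by rewrite ltr0n (leq_trans _ Bm).
rewrite /ergodic_mean mulrC ltr_pdivrMr//.
apply: le_lt_trans (sum_le m z) _; rewrite {2}(splitr e) mulrDl ltrD2l.
rewrite mulrC -ltr_pdivrMr//; apply: lt_le_trans (Num.Theory.truncnS_gt _) _.
by rewrite ler_nat.
Qed.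

(** Vanishing of lower averages passes from [h] to any function [g] that vanishes
    where [h] does.  Applied to functions of pairs of points, this compares
    averages taken with two different metrics. *)
Lemma limn_einf_ergodic_mean_dominated (R : realType) (W : topologicalType)
    (Q : W -> W) (g h : W -> R) w :
  compact [set: W] -> continuous g -> continuous h ->
  (forall w, 0 <= g w) -> (forall w, 0 <= h w) ->
  (forall w, h w = 0 -> g w = 0) ->
  limn_einf (EFin \o (ergodic_mean Q h)^~ w) = 0%E ->
  limn_einf (EFin \o (ergodic_mean Q g)^~ w) = 0%E.
Proof.
move=> cW cg ch g0 h0 gh small.
apply/limn_einf_eq0P => [n|e N e0]; first exact: ergodic_mean_ge0.
have e20 : 0 < e / 2 by rewrite divr_gt0.
have [v /gh -> //|C C0 gC] := compact_dominated cW cg ch h0 _ e20.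
have eC : 0 < e / 2 / C by rewrite divr_gt0.
have hmean0 n : 0 <= ergodic_mean Q h n w by exact: ergodic_mean_ge0.
have [n] := (limn_einf_eq0P hmean0).1 small _ (maxn N 1) eC.
rewrite geq_max => /andP[Nn n0]; rewrite ltr_pdivlMr// mulrC => hn.
exists n => //; apply: le_lt_trans (ergodic_mean_affine_le _ _ n0 gC) _.
by rewrite [ltRHS]splitr ltrD2l.
Qed.

(** * Borel measures from finitely additive set functions *)

Section regular_extension.
Context (R : realType) (Z : ptopologicalType) (nu : set Z -> R).
Hypotheses (hausZ : hausdorff_space Z) (compZ : compact [set: Z]).
Hypotheses (nu_ge0 : forall A, 0 <= nu A) (nuT : nu setT = 1).
Hypothesis nuU : forall A B, A `&` B = set0 -> nu (A `|` B) = nu A + nu B.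

Let inner (U : set Z) : \bar R :=
  ereal_sup [set (nu K)%:E | K in [set K | closed K /\ K `<=` U]].

Let outer (A : set Z) : \bar R :=
  ereal_inf [set inner U | U in [set U | open U /\ A `<=` U]].

Let nu_le A B : A `<=` B -> nu A <= nu B.
Proof.
by move=> AB; rewrite -(setDUK AB) nuU ?setDIK// lerDl.
Qed.

Let nu_leU A B : nu (A `|` B) <= nu A + nu B.
Proof.
rewrite -(setDUK (@subsetUl _ A B)) nuU ?setDIK// lerD2l nu_le//.
by move=> x [[]].
Qed.

Let nu0 : nu set0 = 0.
Proof. by have := @nuU set0 set0 (setI0 _); rewrite setU0; lra. Qed.

Let inner_le U V : U `<=` V -> (inner U <= inner V)%E.
Proof.
move=> UV; apply: ge_ereal_sup => _ [K [cK KU] <-].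
by apply: ereal_sup_ubound; exists K => //; split=> //; exact: subset_trans UV.
Qed.

Let nu_le_inner K U : closed K -> K `<=` U -> ((nu K)%:E <= inner U)%E.
Proof. by move=> cK KU; apply: ereal_sup_ubound; exists K. Qed.

Let inner_ge0 U : (0 <= inner U)%E.
Proof.
by apply: le_trans (@nu_le_inner set0 U closed0 (@sub0set _ _)); rewrite lee_fin.
Qed.

Let inner_le1 U : (inner U <= 1)%E.
Proof.
by apply: ge_ereal_sup => _ [K _ <-]; rewrite lee_fin -nuT; exact: nu_le.
Qed.

Let inner_fin U : inner U \is a fin_num.
Proof.
by rewrite ge0_fin_numE//; apply: le_lt_trans (inner_le1 U) _; rewrite ltry.
Qed.

(** Normality splits a closed subset of [U `|` V] into a closed subset of [U]
    and a closed subset of [V]. *)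
Let inner_leU U V : open U -> open V ->
  (inner (U `|` V) <= inner U + inner V)%E.
Proof.
move=> oU oV; apply: ge_ereal_sup => _ [K [cK KUV] <-].
have cKV : closed (K `\` V) by apply: closedI => //; exact: open_closedC.
have UKV : set_nbhs (K `\` V) U.
  by apply/set_nbhsP; exists U; split=> // x [/KUV[]].
have [W /set_nbhsP[C [oC KVC CW]] WU] := compact_normal hausZ compZ cKV UKV.
rewrite (_ : K = (K `&` closure W) `|` (K `\` C)); last first.
  apply/seteqP; split=> [x Kx|x [[]|[]]//].
  have [Cx|nCx] := pselect (C x); last by right.
  by left; split=> //; apply: subset_closure; exact: CW.
apply: (@le_trans _ _ ((nu (K `&` closure W))%:E + (nu (K `\` C))%:E)%E).
  by rewrite -EFinD lee_fin nu_leU.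
apply: leeD; apply: nu_le_inner.
- by apply: closedI => //; exact: closed_closure.
- by move=> x [_ /WU].
- by apply: closedI => //; exact: open_closedC.
- move=> x [Kx nCx]; have [//|nVx] := pselect (V x).
  by exfalso; apply: nCx; exact: KVC.
Qed.

(** A closed, hence compact, subset of the union is already covered by finitely
    many of the open sets. *)
Let inner_sigma_subadditive (U : (set Z)^nat) : (forall n, open (U n)) ->
  (inner (\bigcup_n U n) <= \sum_(n <oo) inner (U n))%E.
Proof.
move=> oU; apply: ge_ereal_sup => _ [K [cK KU] <-].
have cpK : compact K by exact: subclosed_compact compZ _.
have [|N _ HN] := (compact_near_coveringP K).1 cpK nat \oo
    (fun n z => (\big[setU/set0]_(i < n) U i) z) _.
  move=> z Kz; have [n _ Unz] := KU z Kz.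
  exists (U n, [set m | (n < m)%N]) => /=.
    by split; [exact: open_nbhs_nbhs|exists n.+1].
  by move=> [x m] /= [Ux nm]; rewrite -bigcup_mkord; exists n.
apply: le_trans (nu_le_inner cK (HN N (leqnn N))) _.
apply: le_trans (nneseries_lim_ge N _); last by move=> *; exact: inner_ge0.
rewrite big_mkord; elim: N {HN} => [|n IH].
  by rewrite !big_ord0; apply: ge_ereal_sup => _ [L [_ L0] <-];
    rewrite lee_fin -nu0; exact: nu_le.
rewrite !big_ord_recr /=; apply: le_trans (leeD2r _ IH).
by apply: inner_leU => //; apply: big_ind => //; [exact: open0|exact: openU].
Qed.

Let outer_open U : open U -> outer U = inner U.
Proof.
move=> oU; apply/eqP; rewrite eq_le; apply/andP; split.
  by apply: ereal_inf_lbound; exists U => //; split.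
by apply: le_ereal_inf_tmp => _ [V [_ UV] <-]; exact: inner_le.
Qed.

Let outer_le_inner A U : open U -> A `<=` U -> (outer A <= inner U)%E.
Proof. by move=> oU AU; apply: ereal_inf_lbound; exists U. Qed.

Let outer0 : outer set0 = 0%E.
Proof.
rewrite outer_open; last exact: open0.
apply/eqP; rewrite eq_le inner_ge0 andbT.
by apply: ge_ereal_sup => _ [K [_ K0] <-]; rewrite lee_fin -nu0 nu_le.
Qed.

Let outer_ge0 A : (0 <= outer A)%E.
Proof. by apply: le_ereal_inf_tmp => _ [U _ <-]. Qed.

Let outer_le : {homo outer : A B / A `<=` B >-> (A <= B)%E}.
Proof.
move=> A B AB; apply: le_ereal_inf_tmp => _ [U [oU BU] <-].
by apply: outer_le_inner => //; exact: subset_trans BU.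
Qed.

Let outer_fin A : outer A \is a fin_num.
Proof.
rewrite ge0_fin_numE//; apply: (@le_lt_trans _ _ 1%E); last by rewrite ltry.
by apply: le_trans (inner_le1 setT); apply: outer_le_inner => //; exact: openT.
Qed.

Let outer_sigma_subadditive : sigma_subadditive outer.
Proof.
move=> A; apply/lee_addgt0Pr => e e0.
apply: le_trans (epsilon_trick xpredT (fun n => outer_ge0 (A n)) (ltW e0)).
have [U UP] : {U : (set Z)^nat & forall n, [/\ open (U n), A n `<=` U n &
    (inner (U n) <= outer (A n) + (e / (2 ^ n.+1)%:R)%:E)%E]}.
  apply: (@choice _ _ (fun n U => [/\ open U, A n `<=` U &
    (inner U <= outer (A n) + (e / (2 ^ n.+1)%:R)%:E)%E])) => n.
  have en : 0 < e / (2 ^ n.+1)%:R by rewrite divr_gt0// ltr0n expn_gt0.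
  have [_ [U [oU AU] <-] /ltW Ule] := lb_ereal_inf_adherent en (outer_fin (A n)).
  by exists U.
apply: (@le_trans _ _ (\sum_(n <oo) inner (U n))%E).
  apply: le_trans (inner_sigma_subadditive _) => [|n]; last by case: (UP n).
  apply: outer_le_inner; first by apply: bigcup_open => n _; case: (UP n).
  by move=> x [n _ Ax]; exists n => //; case: (UP n) => _ + _; exact.
apply: lee_nneseries => [n _ _|n _]; first exact: inner_ge0.
by case: (UP n).
Qed.

Let mu : {outer_measure set Z -> \bar R} :=
  HB.pack outer (isOuterMeasure.Build R Z outer outer0 outer_ge0 outer_le
    outer_sigma_subadditive).

(** Inside an open [V], approximate [V `&` U] by a closed set [K], and then the
    open remainder [V `\` K], which contains [V `\` U], by a closed set [L]: the
    disjoint closed sets [K] and [L] are together a closed subset of [V]. *)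
Let open_caratheodory U : open U -> mu.-caratheodory U.
Proof.
move=> oU; apply: le_caratheodory_measurable => X.
apply: le_ereal_inf_tmp => _ [V [oV XV] <-].
rewrite -leeBrDr ?outer_fin//.
apply: (@le_trans _ _ (inner (V `&` U))).
  by apply: outer_le_inner; [exact: openI|exact: setSI].
apply: ge_ereal_sup => _ [K [cK KVU] <-].
rewrite leeBrDr ?outer_fin// addeC -leeBrDr//.
apply: (@le_trans _ _ (inner (V `\` K))).
  apply: outer_le_inner; first by apply: openI => //; exact: closed_openC.
  by move=> x [/XV Vx nUx]; split=> // /KVU[].
apply: ge_ereal_sup => _ [L [cL LVK] <-].
rewrite leeBrDr// -EFinD -nuU; last first.
  by apply/seteqP; split=> // x [/LVK[]].
by apply: nu_le_inner; [exact: closedU|move=> x [/LVK[]|/KVU[]]].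
Qed.

Let borel_caratheodory (A : set (borel Z)) : measurable A -> mu.-caratheodory A.
Proof.
apply: smallest_sub; last exact: open_caratheodory.
exact: (@sigma_algebra_measurable _ (caratheodory_type mu)).
Qed.

(** The measure is recovered from [nu] as for a regular measure: inner regularity
    defines it on open sets, outer regularity on all sets. *)
Lemma regular_borel_extension : exists mu : probability (borel Z) R,
  forall U, open U ->
    mu U = ereal_sup [set (nu K)%:E | K in [set K | closed K /\ K `<=` U]].
Proof.
have outer_sigma_additive : semi_sigma_additive (outer : set (borel Z) -> _).
  move=> F mF tF mUF; apply: (@caratheodory_measure_sigma_additive R Z mu) => //.
    by move=> n; exact: borel_caratheodory.
  exact: borel_caratheodory.
have outerT : outer [set: Z] = 1%E.
  rewrite outer_open; last exact: openT.
  apply/eqP; rewrite eq_le inner_le1 -nuT.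
  by apply: nu_le_inner => //; exact: closedT.
have [m mE] : exists m : {measure set (borel Z) -> \bar R}, m =1 outer.
  pose m : {measure set (borel Z) -> \bar R} :=
    HB.pack (outer : set (borel Z) -> \bar R)
    (isMeasure.Build _ (borel Z) R (outer : set (borel Z) -> \bar R)
       outer0 outer_ge0 outer_sigma_additive).
  by exists m.
have mT : m [set: borel Z] = 1%E by rewrite mE.
(* normalizing [m], of total mass 1, leaves it unchanged but turns it into a
   probability *)
exists (mnormalize m (@dirac _ (borel Z) point R)) => U oU.
rewrite -[RHS](outer_open oU) -mE /= /mnormalize mT.
by rewrite onee_eq0 /= invr1 mule1.
Qed.

End regular_extension.

(** * Invariant measures carried by orbits *)

Lemma ultra_bounded_cvg (R : realType) (I : Type) (G : set_system I)
    (u : I -> R) (a b : R) :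
  UltraFilter G -> (forall i, a <= u i <= b) ->
  exists l : R, u i @[i --> G] --> l.
Proof.
move=> UG uab.
have uabG : (u @ G) [set` `[a, b]].
  by apply: (@filterE _ G) => i /=; rewrite in_itv /=; exact: uab.
have [l [_ ul]] := @segment_compact R a b (u @ G) _ uabG.
exists l; apply/cvgrPdist_lt => e e0.
have [//|farG] := in_ultra_setVsetC [set i | `|l - u i| < e] UG.
have [x /= []] := ul (~` ball l e) (ball l e) farG (nbhsx_ballx _ _ e0).
by [].
Qed.

Lemma open_borel_measurable (Z : ptopologicalType) (U : set (borel Z)) :
  open (U : set Z) -> measurable U.
Proof. by move=> oU; exact: sub_sigma_algebra. Qed.

Lemma closed_borel_measurable (Z : ptopologicalType) (F : set (borel Z)) :
  closed (F : set Z) -> measurable F.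
Proof.
move=> cF; rewrite -(setCK F); apply: measurableC; apply: open_borel_measurable.
exact: closed_openC.
Qed.

Lemma continuous_borel_measurable (Z : ptopologicalType) (S : Z -> Z) :
  continuous S -> measurable_fun [set: borel Z] (S : borel Z -> borel Z).
Proof.
move=> /continuousP cS; apply: (@measurability _ _ (borel Z) (borel Z) setT S (@open Z)) => //.
by move=> _ [U oU <-]; rewrite setTI; apply: open_borel_measurable; exact: cS.
Qed.

Lemma continuous_measurableR (R : realType) (Z : ptopologicalType)
    (f : Z -> R) :
  continuous f -> measurable_fun [set: borel Z] (f : borel Z -> R).
Proof.
move=> /continuousP cf.
apply: (measurability _ (RGenOInfty.measurableE R)).
move=> _ [_ [x ->] <-]; rewrite setTI; apply: open_borel_measurable; apply: cf.
exact: interval_open.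
Qed.

(** The frequencies with which the orbit of [z] visits the sets, passed to the
    limit along an ultrafilter on the times, form an invariant finitely additive
    probability on all subsets of [Z].  If the ultrafilter contains the times at
    which [F] has frequency at least [d], then this limit gives [F] mass at least
    [d].  Its regular Borel extension [mu] is invariant as well: if [K] is a
    closed subset of [S @^-1` U], then the compact set [S @` K] is a subset of [U]
    and no smaller than [K]. *)
Lemma krylov_bogolyubov (R : realType) (Z : ptopologicalType) (S : Z -> Z)
    (F : set Z) (z : Z) (d : R) :
  hausdorff_space Z -> compact [set: Z] -> continuous S -> closed F ->
  (forall N, exists2 n, (N <= n)%N & d <= ergodic_mean S \1_F n z) ->
  exists2 mu, invariant_measures R S mu & (d%:E <= mu F)%E.
Proof.
move=> hausZ compZ cS cF freqF.
pose freq A n : R := ergodic_mean S \1_A n z.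
have freq01 A n : 0 <= freq A n <= 1.
  rewrite ergodic_mean_ge0//=.
  (* the average of length 0 is 0, since [0^-1 = 0] *)
  have [->|n0] := posnP n; first by rewrite /freq /ergodic_mean invr0 mul0r.
  rewrite -[leRHS](@ergodic_mean_cst R Z S 1 n z n0).
  by apply: ergodic_mean_le => y; rewrite indicE lern1 leq_b1.
pose E := [set n | d <= freq F n].
have [G [UG EG]] : exists G, UltraFilter G /\ within E \oo `<=` G.
  apply: ultraFilterLemma; apply: Build_ProperFilter_ex => P [N _ NP].
  by have [n Nn dn] := freqF N; exists n; exact: (NP n).
have ooG : \oo `<=` G.
  by move=> P ooP; apply: EG; apply: filterS ooP => n Pn _.
have GE : G E by apply: EG; exists 0%N.
have [nu nuE] : {nu : set Z -> R & forall A, freq A n @[n --> G] --> nu A}.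
  apply: (@choice _ _ (fun A (l : R) => freq A n @[n --> G] --> l)) => A.
  exact: (ultra_bounded_cvg UG (freq01 A)).
have nu_ge0 A : 0 <= nu A.
  apply: (cvgr_to_ge (nuE A)).
  by apply: filterE => n; case/andP: (freq01 A n).
have nu_eq A (l : R) : freq A n @[n --> G] --> l -> nu A = l.
  by move=> Al; rewrite -(cvg_lim _ (nuE A))// (cvg_lim _ Al).
have nuT : nu setT = 1.
  apply: nu_eq; apply: cvg_near_cst; apply: ooG.
  exists 1%N => // n /= n0; rewrite /freq.
  rewrite (_ : \1_setT = fun=> 1); first exact: ergodic_mean_cst.
  by apply/funext => y; rewrite indicT.
have nuU A B : A `&` B = set0 -> nu (A `|` B) = nu A + nu B.
  move=> AB; apply: nu_eq.
  rewrite (_ : freq (A `|` B) = freq A \+ freq B); first exact: cvgD.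
  apply/funext => n; rewrite /= /freq -ergodic_meanD; congr (ergodic_mean S _ n z).
  apply/funext => y; rewrite !indicE in_setU.
  have [Ay|_] := boolP (y \in A); last by rewrite add0r.
  rewrite [y \in B](_ : _ = false) ?addr0//; apply/negP => By.
  have : (A `&` B) y by split; exact: set_mem.
  by rewrite AB.
have nuS A : nu (S @^-1` A) = nu A.
  apply: nu_eq; rewrite -[nu A]addr0.
  rewrite (_ : freq (S @^-1` A) =
               freq A \+ (fun n => freq (S @^-1` A) n - freq A n)); last first.
    by apply/funext => n /=; rewrite addrC subrK.
  apply: cvgD => //.
  apply/cvgrPdist_lt => e e0; apply: ooG.
  exists (Num.truncn e^-1).+1 => // n /= en; rewrite sub0r normrN.
  rewrite (_ : freq (S @^-1` A) n = ergodic_mean S (\1_A \o S) n z)//.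
  have n0 : (0 : R) < n%:R by rewrite ltr0n (leq_trans _ en).
  rewrite /freq ergodic_mean_shift normrM (@ger0_norm _ n%:R^-1) ?invr_ge0 ?ltW//.
  apply: (@le_lt_trans _ _ n%:R^-1).
    rewrite ger_pMr ?invr_gt0// !indicE.
    by do 2!case: (_ \in _); rewrite ?subrr ?subr0 ?sub0r ?normrN ?normr0 ?normr1.
  rewrite invf_plt ?posrE//; apply: lt_le_trans (Num.Theory.truncnS_gt _) _.
  by rewrite ler_nat.
have nuF : d <= nu F.
  exact: (cvgr_to_ge (nuE F) GE).
have [mu muE] := regular_borel_extension hausZ compZ nu_ge0 nuT nuU.
have open_preS : forall U, open U -> open (S @^-1` U) by apply/continuousP.
have mu_le U : open U -> (mu (S @^-1` U) <= mu U)%E.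
  move=> oU; rewrite !muE//; last exact: open_preS.
  apply: ge_ereal_sup => _ [K [cK KU] <-].
  apply: (@le_trans _ _ (nu (S @` K))%:E).
    rewrite lee_fin -[leRHS]nuS -(setDUK (@preimage_image _ _ S K)) nuU ?setDIK//.
    by rewrite lerDl.
  apply: ereal_sup_ubound; exists (S @` K) => //; split.
    apply: compact_closed => //; apply: continuous_compact.
      exact: continuous_subspaceT.
    exact: subclosed_compact compZ _.
  by move=> _ [x /KU Ux <-].
have mu_open U : open U -> mu (S @^-1` U) = mu U.
  move=> oU; apply/eqP; rewrite eq_le mu_le//= [leLHS]muE//.
  apply: ge_ereal_sup => _ [K [cK KU] <-].
  rewrite -nuS muE; last exact: open_preS.
  apply: ereal_sup_ubound; exists (S @^-1` K) => //; split.
    exact: preimage_closed.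
  by move=> x /KU.
have mS := continuous_borel_measurable cS.
exists mu.
  pose phi : {mfun borel Z >-> borel Z} :=
    HB.pack (S : borel Z -> borel Z) (isMeasurableFun.Build _ _ _ _ _ mS).
  move=> A mA.
  apply: (@measure_unique _ R (borel Z) (@open Z) (fun=> setT) erefl _ _ _
    (pushforward mu phi) mu) => //.
  - by move=> U V; exact: openI.
  - by move=> _; exact: openT.
  - by rewrite bigcup_const//; exists 0%N.
  - by move=> _ /=; rewrite /pushforward preimage_setT probability_setT ltry.
have mFC : measurable (~` F : set (borel Z)).
  by apply: measurableC; exact: closed_borel_measurable.
have := probability_setC mu mFC; rewrite setCK => muF.
have muFC : (mu (~` F) <= (1 - d)%:E)%E.
  rewrite muE; last exact: closed_openC.
  apply: ge_ereal_sup => _ [K [cK KF] <-]; rewrite lee_fin.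
  apply: (@le_trans _ _ (nu (~` F))).
    by rewrite -(setDUK KF) nuU ?setDIK// lerDl.
  have : nu (F `|` ~` F) = nu F + nu (~` F) by rewrite nuU// setICr.
  by rewrite setUCr nuT; move: nuF; lra.
apply: (@le_trans _ _ (1 - mu (~` F))%E); last by rewrite -muF.
rewrite leeBrDr ?fin_num_measure//; apply: (le_trans (leeD2l d%:E muFC)).
by rewrite -EFinD addrC subrK.
Qed.

Lemma level_set_closed (R : realType) (Z : topologicalType) (f : Z -> R) (e : R) :
  continuous f -> closed [set z | e <= f z].
Proof.
move=> cf; apply: (@closed_comp _ _ f [set y | e <= y]); last exact: closed_ge.
by move=> z _; exact: cf.
Qed.

(** An orbit with averages at least [e] infinitely often visits the closed set
    [e / 2 <= f] with a frequency bounded below at those times, because [f] is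
    bounded. *)
Lemma ergodic_mean_cvg0 (R : realType) (Z : ptopologicalType) (S : Z -> Z)
    (f : Z -> R) :
  hausdorff_space Z -> compact [set: Z] -> continuous S -> continuous f ->
  (forall z, 0 <= f z) ->
  (forall mu, invariant_measures R S mu ->
     forall e : R, 0 < e -> mu [set z | e <= f z] = 0%E) ->
  forall z, ergodic_mean S f n z @[n --> \oo] --> (0 : R).
Proof.
move=> hausZ compZ cS cf f0 muf z; apply/cvgrPdist_lt => e e0.
apply: contrapT => far.
have [M M0 fM] : exists2 M : R, 0 < M & forall z, f z <= 1 + M * 1.
  by apply: compact_dominated => // [y|y /eqP]; [exact: cvg_cst|rewrite oner_eq0].
have N0 : 0 < 1 + M by rewrite addr_gt0.
have e20 : 0 < e / 2 by rewrite divr_gt0.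
pose F := [set z | e / 2 <= f z].
have cF : closed F by exact: level_set_closed.
have fF y : f y <= e / 2 + (1 + M) * \1_F y.
  rewrite indicE; have [Fy|] := boolP (y \in F).
    by apply: le_trans (fM y) _; rewrite !mulr1 lerDr ltW.
  by rewrite notin_setE /F /= mulr0 addr0 => /negP; rewrite -ltNge => /ltW.
have d0 : 0 < e / 2 / (1 + M) by rewrite divr_gt0.
have [|mu muS muF] :=
    @krylov_bogolyubov R Z S F z (e / 2 / (1 + M)) hausZ compZ cS cF.
  move=> N; have [n] : exists2 n, (maxn N 1 <= n)%N & e <= ergodic_mean S f n z.
    apply: contrapT => no; apply: far; exists (maxn N 1) => // n /= Nn.
    rewrite sub0r normrN ger0_norm ?ergodic_mean_ge0// ltNge.
    by apply/negP => en; apply: no; exists n.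
  rewrite geq_max => /andP[Nn n0] en; exists n => //.
  have := le_trans en (@ergodic_mean_affine_le _ _ S _ _ _ _ n z n0 fF).
  by rewrite ler_pdivrMr// mulrC; lra.
by move: muF; rewrite muf// lee_fin leNgt d0.
Qed.

(** Integrating the averages of [f] against an invariant measure gives the
    integral of [f]; if the averages are uniformly small, that integral vanishes. *)
Lemma invariant_measure_zero_set (R : realType) (Z : ptopologicalType)
    (S : Z -> Z) (f : Z -> R) mu :
  continuous S -> continuous f -> (forall z, 0 <= f z) ->
  (forall e : R, 0 < e -> \forall n \near \oo, forall z, ergodic_mean S f n z < e) ->
  invariant_measures R S mu -> mu [set z | f z = 0] = 1%E.
Proof.
move=> cS cf f0 small muS.
have mf := continuous_measurableR cf.
have mSn n : measurable_fun [set: borel Z] (iter n S : borel Z -> borel Z).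
  by apply: continuous_borel_measurable; exact: continuous_iter.
have muSn n (A : set (borel Z)) : measurable A -> mu (iter n S @^-1` A) = mu A.
  elim: n A => //= n IH A mA; rewrite -[RHS](muS _ mA) -[RHS]IH//.
  by rewrite -[X in measurable X]setTI; exact: (mSn 1%N).
pose I := (\int[mu]_z (f z)%:E)%E.
have I0 : (0 <= I)%E by apply: integral_ge0 => z _; rewrite lee_fin.
have IS n : (\int[mu]_z (f (iter n S z))%:E = I)%E.
  rewrite -(@ge0_integral_pushforward _ _ (borel Z) (borel Z) R _ (mSn n) mu setT
    (EFin \o f)) //=; last 2 first.
  - exact/measurable_EFinP.
  - by move=> z _; rewrite lee_fin.
  by apply: eq_measure_integral => A mA _; exact: muSn.
have Ie e : 0 < e -> (I <= e%:E)%E.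
  move=> e0; have [N _ Ne] := small e e0.
  pose n := N.+1; have {}Ne z : ergodic_mean S f n z < e := Ne n (leqnSn N) z.
  have mfS i : measurable_fun [set: borel Z]
      (fun z : borel Z => (f (iter i S z))%:E).
    apply/measurable_EFinP.
    apply: (@continuous_measurableR R Z (fun z => f (iter i S z))) => z.
    exact: (continuous_comp (@continuous_iter _ _ i cS z) (cf _)).
  have sumI : (\sum_(0 <= i < n) I <= (e * n%:R)%:E)%E.
    rewrite -(eq_bigr _ (fun i _ => IS i)) -ge0_integral_sum//; last first.
      by move=> i z _; rewrite lee_fin.
    rewrite -[leRHS]mule1 -(probability_setT mu) -integral_cst//.
    apply: ge0_le_integral => //.
    - by move=> z _; apply: sume_ge0 => i _; rewrite lee_fin.
    - exact: emeasurable_sum.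
    - move=> z _; rewrite sumEFin lee_fin.
      by move: (Ne z); rewrite /ergodic_mean mulrC ltr_pdivrMr ?ltr0n// => /ltW.
  have Ifin : I \is a fin_num.
    rewrite ge0_fin_numE//; apply: le_lt_trans (ltry (e * n%:R)).
    apply: le_trans sumI; rewrite big_nat_recl//=.
    by rewrite leeDl// sume_ge0.
  move: sumI; rewrite -(fineK Ifin) sumEFin sumr_const_nat subn0 !lee_fin.
  by rewrite -[fine I *+ n]mulr_natr ler_pM2r ?ltr0n.
have I00 : I = 0%E.
  apply/eqP; rewrite eq_le I0 andbT; apply/lee_addgt0Pr => e e0.
  by rewrite add0e Ie.
pose Z0 : set (borel Z) := [set z | f z = 0].
have mZ0 : measurable Z0.
  apply: closed_borel_measurable; apply: (@closed_comp _ _ f [set 0]).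
    by move=> z _; exact: cf.
  exact: closed_eq.
have Z0C : mu (~` Z0) = 0%E.
  apply/negligibleP; first exact: measurableC.
  have : (\int[mu]_z `|(EFin \o f) z| = 0)%E.
    by rewrite -I00; apply: eq_integral => z _ /=; rewrite ger0_norm.
  move=> /ae_eq_integral_abs -/(_ measurableT) ae0.
  have /ae0 : measurable_fun [set: borel Z] (EFin \o f : borel Z -> \bar R).
    exact/measurable_EFinP.
  apply: filterS => z /(_ Logic.I) /= [] fz.
  by rewrite /Z0 /=.
by have := probability_setC mu (measurableC mZ0); rewrite setCK Z0C sube0.
Qed.

(** * Metrics inducing a given topology *)

Section compatible_metric.
Context (R : realType) (Y : ptopologicalType) (rho : Y -> Y -> R).
Hypothesis rhoP : compatible_metric rho.

Lemma compatible_metric_ge0 x y : 0 <= rho x y.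
Proof.
case: rhoP => rho0 _ rhoC rhoD _.
by have := rhoD x y x; rewrite rho0 (rhoC y x); lra.
Qed.

Lemma compatible_metric_near x (e : R) : 0 < e -> \forall y \near x, rho x y < e.
Proof.
move=> e0; case: rhoP => _ _ _ _ nbhsE.
suff : nbhs x [set y | rho x y < e] by [].
by rewrite nbhsE; exists e.
Qed.

Lemma compatible_metric_continuous : continuous (fun p : Y * Y => rho p.1 p.2).
Proof.
case: rhoP => _ _ rhoC rhoD _ [x y]; apply/cvgrPdist_lt => e e0.
have e20 : 0 < e / 2 by rewrite divr_gt0.
exists ([set x' | rho x x' < e / 2], [set y' | rho y y' < e / 2]).
  by split; exact: compatible_metric_near.
move=> [x' y'] /= [xx' yy'].
have := rhoD x x' y; have := rhoD x' y' y.
have := rhoD x' x y'; have := rhoD x y y'.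
rewrite (rhoC x' x) (rhoC y' y) ltr_norml; move=> *; apply/andP; split; lra.
Qed.

Lemma compatible_metric_hausdorff : hausdorff_space Y.
Proof.
case: rhoP => rho0 rho_eq rhoC rhoD _ x y xy; apply: rho_eq.
apply/eqP; rewrite eq_le compatible_metric_ge0 andbT.
apply/ler_addgt0Pr => e e0; rewrite add0r.
have e20 : 0 < e / 2 by rewrite divr_gt0.
have [z [/= xz yz]] := xy _ _ (compatible_metric_near x e20)
  (compatible_metric_near y e20).
have := rhoD x z y; rewrite (rhoC z y); lra.
Qed.

End compatible_metric.

Lemma mdist_compatible (R : realType) (X : metricType R) :
  compatible_metric (@mdist R X).
Proof.
split=> [x|x y|x y|x y z|x].
- exact: mdistxx.
- exact: mdist_positivity.
- exact: metric_sym.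
- exact: metric_triangle.
- rewrite -nbhs_ballE; congr (nbhs_ball_ _ x).
  by apply/funext => y; apply/funext => e; rewrite ballEmdist.
Qed.

(** * Mean proximality, mean asymptoticity and point masses *)

Lemma continuous_prod_map (Y : topologicalType) (T : Y -> Y) :
  continuous T -> continuous (prod_map T).
Proof.
move=> cT p; apply: cvg_pair => /=.
  exact: (continuous_comp (@cvg_fst _ _ _ _ _) (cT p.1)).
exact: (continuous_comp (@cvg_snd _ _ _ _ _) (cT p.2)).
Qed.

Lemma mean_dist_funE (R : realType) (Y : Type) (rho : Y -> Y -> R) (T : Y -> Y) x y :
  mean_dist rho T x y =
  (ergodic_mean (prod_map T) (fun p => rho p.1 p.2))^~ (x, y).
Proof. by apply/funext => n; exact: mean_distE. Qed.

Lemma compactXX (Y : topologicalType) :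
  compact [set: Y] -> compact [set: Y * Y].
Proof. by move=> cY; rewrite -setXTT; exact: compact_setX. Qed.

Lemma mean_proximal_uniform (R : realType) (Y : ptopologicalType)
    (rho : Y -> Y -> R) (T : Y -> Y) :
  compatible_metric rho -> compact [set: Y] -> continuous T ->
  mean_proximal rho T -> forall e : R, 0 < e -> \forall n \near \oo,
  forall p, ergodic_mean (prod_map T) (fun p => rho p.1 p.2) n p < e.
Proof.
move=> rhoP cY cT prox; apply: uniformly_small_ergodic_mean.
- exact: compactXX.
- exact: continuous_prod_map.
- exact: compatible_metric_continuous.
- by move=> p; exact: compatible_metric_ge0.
move=> [x y] e e0; have := prox x y; rewrite /mean_proximal_pair mean_dist_funE.
move=> /limn_einf_eq0P small.
have [|n n0 ne] := small _ e 1%N e0; last by exists n.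
by move=> n; apply: ergodic_mean_ge0 => p; exact: compatible_metric_ge0.
Qed.

Lemma mean_proximal_asymptotic (R : realType) (Y : ptopologicalType)
    (rho : Y -> Y -> R) (T : Y -> Y) :
  compatible_metric rho -> compact [set: Y] -> continuous T ->
  mean_proximal rho T -> mean_asymptotic rho T.
Proof.
move=> rhoP cY cT prox x y; rewrite /mean_asymptotic_pair mean_dist_funE.
apply/cvgrPdist_lt => e e0.
apply: filterS (mean_proximal_uniform rhoP cY cT prox e0) => n /(_ (x, y)).
rewrite sub0r normrN ger0_norm//; apply: ergodic_mean_ge0 => p.
exact: compatible_metric_ge0.
Qed.

Lemma mean_asymptotic_proximal (R : realType) (Y : Type)
    (rho : Y -> Y -> R) (T : Y -> Y) :
  mean_asymptotic rho T -> mean_proximal rho T.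
Proof.
move=> asym x y; rewrite /mean_proximal_pair.
suff /cvg_limn_einf_sup[-> _//] : (EFin \o mean_dist rho T x y) @ \oo --> 0%E.
by apply: cvg_EFin; [exact: nearW|exact: asym].
Qed.

Definition coord_sum (R : realType) (Y : Type) (f : Y -> R) (p : Y * Y) : R :=
  f p.1 + f p.2.

Lemma coord_sum_ge0 (R : realType) (Y : Type) (f : Y -> R) :
  (forall y, 0 <= f y) -> forall p, 0 <= coord_sum f p.
Proof. by move=> f0 p; rewrite addr_ge0. Qed.

Lemma coord_sum_eq0 (R : realType) (Y : Type) (f : Y -> R) p :
  (forall y, 0 <= f y) -> coord_sum f p = 0 -> f p.1 = 0 /\ f p.2 = 0.
Proof.
by move=> f0 /eqP; rewrite paddr_eq0// => /andP[/eqP ? /eqP].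
Qed.

Lemma continuous_coord_sum (R : realType) (Y : topologicalType) (f : Y -> R) :
  continuous f -> continuous (coord_sum f).
Proof.
move=> cf p; apply: (@continuousD _ _ _ (fun p => f p.1) (fun p => f p.2)).
  exact: (continuous_comp (@cvg_fst _ _ _ _ _) (cf p.1)).
exact: (continuous_comp (@cvg_snd _ _ _ _ _) (cf p.2)).
Qed.

Lemma ergodic_mean_coord_sum_cvg0 (R : realType) (Y : Type) (S : Y -> Y)
    (f : Y -> R) :
  (forall y, ergodic_mean S f n y @[n --> \oo] --> (0 : R)) ->
  forall p, ergodic_mean (prod_map S) (coord_sum f) n p @[n --> \oo] --> (0 : R).
Proof.
move=> f0 p.
rewrite (_ : (ergodic_mean _ _)^~ p =
    (fun n => ergodic_mean S f n p.1 + ergodic_mean S f n p.2)).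
  by rewrite -[0 : R]addr0; apply: cvgD; exact: f0.
apply/funext => n; rewrite -(@ergodic_mean_factor _ _ _ (prod_map S) S fst)//.
rewrite -(@ergodic_mean_factor _ _ _ (prod_map S) S snd)//.
exact: ergodic_meanD.
Qed.

Section metric_system.
Context (R : realType) (X : pmetricType R) (T : X -> X).
Hypotheses (compX : compact [set: X]) (cT : continuous T).

Let d (p : X * X) : R := mdist p.1 p.2.

Let dP : compatible_metric (@mdist R X) := @mdist_compatible R X.

Let cd : continuous d. Proof. exact: compatible_metric_continuous. Qed.

Let d_ge0 p : 0 <= d p. Proof. exact: mdist_ge0. Qed.

Let diagonalE : [set p | d p = 0] = @diagonal X.
Proof.
apply/seteqP; split=> -[x y] /=; first exact: mdist_positivity.
by rewrite /diagonal /d /= => ->; exact: mdistxx.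
Qed.

Lemma mean_asymptotic_diagonal : mean_asymptotic (@mdist R X) T ->
  forall lambda, invariant_measures R (prod_map T) lambda ->
    lambda (@diagonal X) = 1%E.
Proof.
move=> asym lambda inv; rewrite -diagonalE.
apply: (invariant_measure_zero_set (continuous_prod_map cT) cd) => //.
apply: mean_proximal_uniform => //; exact: mean_asymptotic_proximal.
Qed.

(** The orbit of a pair whose averages do not tend to 0 would give rise to an
    invariant measure charging the complement of the diagonal. *)
Lemma diagonal_mean_asymptotic :
  (forall lambda, invariant_measures R (prod_map T) lambda ->
    lambda (@diagonal X) = 1%E) ->
  mean_asymptotic (@mdist R X) T.
Proof.
move=> diag x y; rewrite /mean_asymptotic_pair mean_dist_funE.
apply: (ergodic_mean_cvg0 (S := prod_map T) (f := d)) => //.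
- exact: (compatible_metric_hausdorff (max_dist_compatible X)).
- exact: compactXX.
- exact: continuous_prod_map.
move=> lambda inv e e0.
have mD : measurable (@diagonal X : set (borel (X * X)%type)).
  rewrite -diagonalE; apply: closed_borel_measurable.
  apply: (@closed_comp _ _ d [set 0]); first by move=> p _; exact: cd.
  exact: closed_eq.
have DC : lambda (~` @diagonal X : set (borel (X * X)%type)) = 0%E.
  by rewrite (probability_setC lambda mD) diag// subee.
apply: (subset_measure0 _ _ _ DC).
- by apply: (@closed_borel_measurable (X * X)%type); exact: level_set_closed.
- exact: measurableC.
- by move=> p /= ep; rewrite -diagonalE /= => dp; move: ep; rewrite dp leNgt e0.
Qed.

(** Without a fixed point the displacement [h x := d (x, T x)] would be bounded
    below; but its averages along an orbit are those of the pair formed by a point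
    and its image. *)
Lemma mean_asymptotic_fixed_point :
  mean_asymptotic (@mdist R X) T -> exists x0, T x0 = x0.
Proof.
move=> asym; apply: contrapT => nofix.
pose h x := d (x, T x).
have ch : continuous h.
  move=> x; apply: (@continuous_comp _ _ _ (fun x => (x, T x)) d); last exact: cd.
  by apply: cvg_pair; [exact: cvg_id|exact: cT].
have e0 : 0 < 1 / 2 :> R by rewrite divr_gt0.
have [C C0 hC] : exists2 C : R, 0 < C & forall x, 1 <= 1 / 2 + C * h x.
  apply: (compact_dominated (g := fun=> 1)) => //.
  - by move=> x; exact: cvg_cst.
  - by move=> x; exact: d_ge0.
  by move=> x hx; exfalso; apply: nofix; exists x; apply/esym/mdist_positivity.
have small := mean_asymptotic_proximal asym point (T point).
have eC : 0 < 1 / 2 / C by rewrite divr_gt0.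
have dmean0 n : 0 <= mean_dist (@mdist R X) T point (T point) n.
  by rewrite mean_distE; exact: ergodic_mean_ge0.
have [n n0] := (limn_einf_eq0P dmean0).1 small _ 1%N eC.
have -> : mean_dist (@mdist R X) T point (T point) n = ergodic_mean T h n point.
  by congr (_ * _); apply: eq_bigr => i _; rewrite /h /d /= -iterSr.
rewrite ltr_pdivlMr// mulrC => hn.
have := ergodic_mean_affine_le T point n0 hC.
by rewrite ergodic_mean_cst//; lra.
Qed.

Let dist_to (x0 y : X) : R := mdist y x0.

Let mean_dist_fixed x0 x n : T x0 = x0 ->
  mean_dist (@mdist R X) T x x0 n =
  ergodic_mean T (dist_to x0) n x.
Proof.
move=> Tx0; congr (_ * _); apply: eq_bigr => i _; congr (mdist _ _).
by rewrite iter_fix.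
Qed.

Let continuous_dist_to x0 : continuous (dist_to x0).
Proof.
move=> y; apply: (@continuous_comp _ _ _ (fun y => (y, x0)) d y); last exact: cd.
by apply: cvg_pair; [exact: cvg_id|exact: cvg_cst].
Qed.

Lemma dirac_invariant (x0 : X) : T x0 = x0 ->
  invariant_measures R T (@dirac _ (borel X) x0 R).
Proof.
move=> Tx0 A mA; rewrite /= !diracE; congr ((nat_of_bool _)%:R%:E).
by apply/idP/idP => /set_mem Ax0; apply/mem_set; move: Ax0; rewrite /preimage /= Tx0.
Qed.

(** Averages of the distance to [x0] are averages over the pairs [(x, x0)], hence
    uniformly small, so that this distance vanishes almost everywhere. *)
Lemma mean_asymptotic_dirac (x0 : X) : mean_asymptotic (@mdist R X) T -> T x0 = x0 ->
  forall mu, invariant_measures R T mu ->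
    borel_eq mu (@dirac _ (borel X) x0 R).
Proof.
move=> asym Tx0 mu inv A mA.
have mux0 : mu [set y | dist_to x0 y = 0] = 1%E.
  apply: (invariant_measure_zero_set cT (@continuous_dist_to x0)) => //.
    by move=> y; exact: mdist_ge0.
  move=> e e0; have prox := mean_asymptotic_proximal asym.
  apply: filterS (mean_proximal_uniform dP compX cT prox e0) => n small x.
  by rewrite -mean_dist_fixed// mean_distE.
have x0E : [set y | dist_to x0 y = 0] = [set x0].
  apply/seteqP; split=> y /=; first exact: mdist_positivity.
  by move=> ->; exact: mdistxx.
rewrite {}x0E in mux0.
have mx0 : measurable ([set x0] : set (borel X)).
  apply: closed_borel_measurable; apply: accessible_closed_set1.
  exact/hausdorff_accessible/compatible_metric_hausdorff/dP.
rewrite diracE; have [/set_mem Ax0|Ax0] := boolP (x0 \in A).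
  apply/eqP; rewrite eq_le probability_le1//= -mux0.
  by apply: le_measure; rewrite ?inE// => _ ->.
have x0C : mu (~` [set x0]) = 0%E by rewrite (probability_setC mu mx0) mux0 subee.
apply: (subset_measure0 _ _ _ x0C) => //.
- exact: measurableC.
- by move=> y Ay yx0; move: Ax0; rewrite notin_setE -yx0.
Qed.

Lemma mean_asymptotic_unique_fixed x0 x : mean_asymptotic (@mdist R X) T ->
  T x0 = x0 -> T x = x -> x = x0.
Proof.
move=> asym Tx0 Tx; apply: (@mdist_positivity R).
apply: (@norm_cvg_unique _ _ (mean_dist (@mdist R X) T x x0 @ \oo)); last exact: asym.
apply: cvg_near_cst; exists 1%N => // n /= n0.
rewrite -[RHS](@ergodic_mean_cst R X T _ n x n0); congr (_ * _).
by apply: eq_bigr => i _; rewrite !iter_fix.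
Qed.

(** Two points of the square are at distance 0 for [rho] once all four of their
    coordinates are at distance 0 from [x0], and the averages of the sum of these
    four distances tend to 0. *)
Lemma dirac_mean_proximal_prod (x0 : X) (rho : X * X -> X * X -> R) :
  compatible_metric rho ->
  (forall mu, invariant_measures R T mu ->
     borel_eq mu (@dirac _ (borel X) x0 R)) ->
  mean_proximal rho (prod_map T).
Proof.
move=> rhoP only_dirac.
pose f := dist_to x0.
have f0 y : 0 <= f y by exact: mdist_ge0.
have cf : continuous f by exact: continuous_dist_to.
have fcvg : forall x, ergodic_mean T f n x @[n --> \oo] --> (0 : R).
  apply: ergodic_mean_cvg0 => //; first exact: compatible_metric_hausdorff dP.
  move=> mu inv e e0; rewrite only_dirac//; last first.
    by apply: (@closed_borel_measurable X); exact: level_set_closed.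
  by rewrite diracE memNset//= /f /dist_to mdistxx leNgt e0.
pose h := coord_sum (coord_sum f).
move=> p q; rewrite /mean_proximal_pair mean_dist_funE.
apply: (limn_einf_ergodic_mean_dominated (h := h)).
- exact/compactXX/compactXX.
- exact: compatible_metric_continuous.
- exact/continuous_coord_sum/continuous_coord_sum.
- by move=> w; exact: compatible_metric_ge0.
- exact/coord_sum_ge0/coord_sum_ge0.
- move=> [[a b] [a' b']] /(coord_sum_eq0 (coord_sum_ge0 f0)) /= [].
  move=> /(coord_sum_eq0 f0) /= [fa fb] /(coord_sum_eq0 f0) /= [fa' fb'].
  rewrite (mdist_positivity _ _ fa) (mdist_positivity _ _ fb).
  rewrite (mdist_positivity _ _ fa') (mdist_positivity _ _ fb').
  by case: rhoP.
suff /cvg_limn_einf_sup[-> _//] :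
  (EFin \o (ergodic_mean (prod_map (prod_map T)) h)^~ (p, q)) @ \oo --> 0%E.
apply: cvg_EFin; first exact: nearW.
exact/ergodic_mean_coord_sum_cvg0/ergodic_mean_coord_sum_cvg0.
Qed.

(** The pair [(x, y)] is tested on the points [(x, x)] and [(y, y)] of the square. *)
Lemma mean_proximal_prod (rho : X * X -> X * X -> R) :
  compatible_metric rho ->
  mean_proximal rho (prod_map T) -> mean_proximal (@mdist R X) T.
Proof.
move=> rhoP prox x y; have := prox (x, x) (y, y).
rewrite /mean_proximal_pair !mean_dist_funE => prox_xy.
pose pi (w : (X * X) * (X * X)) := (w.1.1, w.2.1).
have -> : (ergodic_mean (prod_map T) d)^~ (x, y) =
    (ergodic_mean (prod_map (prod_map T)) (d \o pi))^~ ((x, x), (y, y)).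
  by apply/funext => n; rewrite (@ergodic_mean_factor _ _ _ _ (prod_map T)).
apply: limn_einf_ergodic_mean_dominated prox_xy.
- exact/compactXX/compactXX.
- move=> w; apply: (@continuous_comp _ _ _ pi d); last exact: cd.
  apply: cvg_pair => /=.
    exact: (continuous_comp (@cvg_fst _ _ _ _ _) (@cvg_fst _ _ _ _ _)).
  exact: (continuous_comp (@cvg_snd _ _ _ _ _) (@cvg_fst _ _ _ _ _)).
- exact: compatible_metric_continuous.
- by move=> w; exact: d_ge0.
- by move=> w; exact: compatible_metric_ge0.
- case: rhoP => _ rho_eq _ _ _ w /rho_eq; rewrite /d /= => ->.
  exact: mdistxx.
Qed.

End metric_system.

Theorem theorem1p2 (R : realType) (X : pmetricType R) (T : X -> X)
    (rho : X * X -> X * X -> R) :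
  compact [set: X] -> continuous T -> compatible_metric rho ->
  [<-> mean_proximal (@mdist R X) T;
       mean_asymptotic (@mdist R X) T;
       (forall lambda, invariant_measures R (prod_map T) lambda ->
          lambda (@diagonal X) = 1%E);
       (uniquely_ergodic R T /\
        exists x0 : X,
          [/\ T x0 = x0,
              forall y, T y = y -> y = x0
            & forall mu, invariant_measures R T mu ->
                borel_eq mu (@dirac _ (borel X) x0 R)]);
       mean_proximal rho (prod_map T)].
Proof.
move=> compX cT rhoP; tfae.
- exact: (mean_proximal_asymptotic (mdist_compatible X)).
- exact: mean_asymptotic_diagonal.
- move=> /(diagonal_mean_asymptotic compX cT) asym.
  have [x0 Tx0] := mean_asymptotic_fixed_point compX cT asym.
  have only_dirac := mean_asymptotic_dirac compX cT asym Tx0.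
  split.
    exists (@dirac _ (borel X) x0 R : probability (borel X) R) => //.
    exact: dirac_invariant.
  exists x0; split=> // y; exact: mean_asymptotic_unique_fixed.
- move=> [_ [x0 [_ _ only_dirac]]].
  exact: (dirac_mean_proximal_prod compX cT rhoP only_dirac).
- exact: mean_proximal_prod.
Qed.
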